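(* Let $f$ be a choice function and $\bar S\in\mathcal{P}(\mathcal{L})$. For all $\lambda\ge 0$, all $S\subseteq\bar S$ and all $t\in\{0,\dots,T(\lambda)\}$, $V_t^*(S)\le V_t^U(S)$. In addition, when $f=\rho$ is the MNL choice function, $\lim_{\lambda\to\infty}\big(V^*_{T(\lambda)}(S)-V^U_{T(\lambda)}(S)\big)=0$ for all $S\subseteq\bar S$.
   Context: Items and options: $\mathcal{L}=\{1,\dots,L\}$ is a finite set of unique items; item $j$ has salvage value $\xi_j\in\mathbb{R}$. An option is a sequence of distinct items (a single item, or a bundle of two or more items); the salvage value $\xi_i$ of an option $i$ is the sum of the salvage values of its items. $\mathcal{O}$ is the set of all options with at most $K_b$ items, and $\mathcal{P}(\mathcal{L})$ is the collection of all sets $S\subseteq\mathcal{O}$ such that each item belongs to exactly one option of $S$ and $S$ contains at most $K_s$ bundles ($K_b,K_s$ given integers). Customers: $\Omega$ is a finite set of customer types; $X$ is a random type with probability mass function $p_X$ on $\Omega$, and $\mathbb{E}_X$ is expectation over $X$. In each period a customer arrives with probability $\mu\in(0,1]$ (fixed), with type distributed as $X$ independently across periods. For demand $\lambda\ge0$ the number of periods is $T(\lambda)=\lfloor\lambda/\mu\rfloor$; periods are indexed by remaining time $t$. Choice function: $f_i^\omega(p,S)$ is the probability that a customer of type $\omega$ accepts option $i$ when the set $S$ is displayed at prices $p$ (only the prices of options in $S$ matter), with $f^\omega(\cdot,S):\mathbb{R}^{|S|}\to[0,1]^{|S|}$ differentiable; it is considered for members $S$ of $\mathcal{P}(\mathcal{L})$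 and their subsets. $f$ is a choice function if for all $S\in\mathcal{P}(\mathcal{L})$ and $\omega\in\Omega$: (p.1) $\sum_{i\in S}f_i^\omega(p,S)\le1$ for all $p\in\mathbb{R}^{|S|}$; (p.2) $f_i^\omega(p,S)=0$ for $i\notin S$; (p.3) $\lim_{p_i\to\infty}p_if_i^\omega(p,S)=0$ for $i\in S$; (p.4) there is $\tilde f^\omega:\mathbb{R}^{|S|}\times[0,1]^{|S|}\to[0,1]^{|S|}$ such that $\tilde f_i^\omega(p,a)$ is non-increasing and convex in $a$ and $\tilde f_i^\omega(p,a(S'))=f_i^\omega(p,S')$ for all $S'\subseteq S$ with $i\in S'$, where $a_j(S')=\mathbf{1}_{\{j\in S'\}}$; (p.5) for all $i\in S$ the mapping $p\mapsto p+f_i^\omega(p,\{i\})\big/\frac{\partial}{\partial p_i}f_i^\omega(p,\{i\})$ is well-defined and non-decreasing in $p_i$. MNL choice function: with qualities $q_i^\omega\in\mathbb{R}$ and price sensitivity $\beta_p<0$, $\rho_i^\omega(p,S)=\dfrac{e^{q_i^\omega+\beta_pp_i}}{1+\sum_{j\in S}e^{q_j^\omega+\beta_pp_j}}$ for $i\in S$. Value function: for every $S'$ contained in some member of $\mathcal{P}(\mathcal{L})$, $V_0^*(S')=\sum_{i\in S'}\xi_i$ and, for $t\ge1$, $V_t^*(S')=V_{t-1}^*(S')+\mu\,\mathbb{E}_X\big[R(f^X,S',\Delta V_t^*(S'))\big]$, where $\Delta_iV_t^*(S')=V^*_{t-1}(S')-V^*_{t-1}(S'\setminus\{i\})$ and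 $R(g,S',\Delta)=\max_{p\in\mathbb{R}^{|S'|}}\sum_{i\in S'}g_i(p,S')(p_i-\Delta_i)$. Backward upper bound: for $i\in\bar S$, $r_{0,i}=\xi_i$ and $r_{t,i}=r_{t-1,i}+\mu\,\mathbb{E}_X\big[\max_{p\in\mathbb{R}}f_i^X(p,\{i\})(p-r_{t-1,i})\big]$ for $t\ge1$; $V_t^U(S)=\sum_{i\in S}r_{t,i}$.
   Formalization: Conditions (p.1)–(p.5) are required for every subset of a member of P(L), not only for members; otherwise the bound can fail (acceptance probabilities on a proper subset summing to more than 1) or the maxima may not exist. The maxima over prices are read as suprema. *)

(* Defs.v *)
From HB Require Import structures.
From mathcomp Require Import all_boot all_order all_algebra.
From mathcomp Require Import all_classical all_reals all_analysis.

Set Implicit Arguments.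
Unset Strict Implicit.
Unset Printing Implicit Defensive.

Import Order.TTheory GRing.Theory Num.Theory.
Import numFieldNormedType.Exports.

Local Open Scope classical_set_scope.
Local Open Scope ring_scope.

(* [opt L Kb]: nonempty sequences of distinct items, of length at most Kb; the
   order of the items matters.  A bundle is an option of length at least 2. *)
Definition opt (L Kb : nat) : finType :=
  {s : Kb.-bseq 'I_L | uniq s && (0 < size s)%N}.

Definition items (L Kb : nat) (i : opt L Kb) : seq 'I_L := val i.

Definition salvage (R : realType) (L Kb : nat) (xi : 'I_L -> R)
  (i : opt L Kb) : R := \sum_(j <- items i) xi j.

(* The collection P(L). *)
Definition feasible (L Kb Ks : nat) (S : {set opt L Kb}) : bool :=
  [forall j : 'I_L, #|[set i in S | j \in items i]| == 1%N]
  && (#|[set i in S | (1 < size (items i))%N]| <= Ks)%N.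

(* The sets that may be displayed: members of P(L) and their subsets. *)
Definition displayable (L Kb Ks : nat) (S : {set opt L Kb}) : Prop :=
  exists2 S0 : {set opt L Kb}, feasible Ks S0 & S \subset S0.

(* A price vector has one coordinate per option in O.  A function on R^|S| is
   represented as a function of the full vector that only looks at the
   coordinates in S (see [cf_local] below); it is then differentiable as a
   function on R^|S| iff it is so as a function of the full vector. *)
Notation prices R L Kb := ('rV[R]_#|opt L Kb|) (only parsing).

Definition price (R : realType) (L Kb : nat) (p : prices R L Kb)
  (i : opt L Kb) : R := p ord0 (enum_rank i).

Definition set_price (R : realType) (L Kb : nat) (p : prices R L Kb)
    (i : opt L Kb) (x : R) : prices R L Kb :=
  \row_(k < #|opt L Kb|) (if k == enum_rank i then x else p ord0 k).

(* [g S p i] is the probability g_i(p, S) for a fixed customer type. *)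
Definition choice_prob (R : realType) (L Kb : nat) : Type :=
  {set opt L Kb} -> prices R L Kb -> opt L Kb -> R.

(* g_i(x, {i}) as a function of the scalar price x of i: the prices of the
   other options are irrelevant, so all coordinates are set to x. *)
Definition single (R : realType) (L Kb : nat) (g : choice_prob R L Kb)
  (i : opt L Kb) (x : R) : R := g [set i]%SET (const_mx x) i.

(* The cube [0, 1]^|S|, as vectors indexed by all options that vanish off S. *)
Definition cube (R : realType) (L Kb : nat) (S : {set opt L Kb})
    (a : opt L Kb -> R) : Prop :=
  (forall j, j \in S -> 0 <= a j <= 1) /\ (forall j, j \notin S -> a j = 0).

Definition indic01 (R : realType) (L Kb : nat) (S : {set opt L Kb})
  (j : opt L Kb) : R := (j \in S)%:R.

Definition nonincreasing_on_cube (R : realType) (L Kb : nat)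
    (S : {set opt L Kb}) (h : (opt L Kb -> R) -> R) : Prop :=
  forall a b, cube S a -> cube S b -> (forall j, a j <= b j) -> h b <= h a.

Definition convex_on_cube (R : realType) (L Kb : nat)
    (S : {set opt L Kb}) (h : (opt L Kb -> R) -> R) : Prop :=
  forall a b, cube S a -> cube S b -> forall s : R, 0 <= s <= 1 ->
    h (fun j => s * a j + (1 - s) * b j) <= s * h a + (1 - s) * h b.

(* All conditions are imposed on every set that may be displayed, not only on
   the members of P(L): the value function is built from proper subsets too, and
   the upper bound fails if, say, [cf_p1] is dropped for them. *)
Record choice_function (R : realType) (L Kb Ks : nat) (Omega : finType)
    (f : Omega -> choice_prob R L Kb) : Prop := ChoiceFunction {
  cf_local : forall w S, displayable Ks S ->
    forall p p' : prices R L Kb,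
    (forall j, j \in S -> price p j = price p' j) ->
    forall i, i \in S -> f w S p i = f w S p' i ;
  cf_range : forall w S, displayable Ks S ->
    forall (p : prices R L Kb) i, i \in S -> 0 <= f w S p i <= 1 ;
  cf_diff : forall w S, displayable Ks S ->
    forall (p : prices R L Kb) i, i \in S ->
    differentiable (fun p' : prices R L Kb => f w S p' i) p ;
  cf_p1 : forall w S, displayable Ks S ->
    forall p : prices R L Kb, \sum_(i in S) f w S p i <= 1 ;
  cf_p2 : forall w S, displayable Ks S ->
    forall (p : prices R L Kb) i, i \notin S -> f w S p i = 0 ;
  cf_p3 : forall w S, displayable Ks S ->
    forall (p : prices R L Kb) i, i \in S ->
    (x * f w S (set_price p i x) i) @[x --> +oo] --> (0 : R) ;
  cf_p4 : forall w S, displayable Ks S ->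
    exists ft : prices R L Kb -> (opt L Kb -> R) -> opt L Kb -> R,
      forall (p : prices R L Kb) i, i \in S ->
      [/\ forall a, cube S a -> 0 <= ft p a i <= 1,
          nonincreasing_on_cube S (fun a => ft p a i),
          convex_on_cube S (fun a => ft p a i) &
          forall S' : {set opt L Kb}, S' \subset S -> i \in S' ->
            ft p (indic01 R S') i = f w S' p i] ;
  cf_p5 : forall w S, displayable Ks S -> forall i, i \in S ->
    (forall x : R, derive1 (single (f w) i) x != 0) /\
    {homo (fun x : R => x + single (f w) i x / derive1 (single (f w) i) x)
       : x y / x <= y}
}.

(* The multinomial logit choice function. *)
Definition mnl (R : realType) (L Kb : nat) (Omega : finType)
    (q : Omega -> opt L Kb -> R) (beta : R) (w : Omega) : choice_prob R L Kb :=
  fun S p i => if i \in S then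
      expR (q w i + beta * price p i) /
        (1 + \sum_(j in S) expR (q w j + beta * price p j))
    else 0.

Definition is_pmf (R : realType) (Omega : finType) (pX : Omega -> R) : Prop :=
  (forall w, 0 <= pX w) /\ \sum_(w : Omega) pX w = 1.

Definition expect (R : realType) (Omega : finType) (pX : Omega -> R)
  (h : Omega -> R) : R := \sum_(w : Omega) pX w * h w.

(* The maxima over prices are suprema in R, equal to the maximum whenever it is
   attained.  For a choice function the suprema are over nonempty sets bounded
   above, so the default value of [sup] does not come into play. *)
Definition max_revenue (R : realType) (L Kb : nat) (g : choice_prob R L Kb)
    (S : {set opt L Kb}) (D : opt L Kb -> R) : R :=
  sup [set v | exists p : prices R L Kb,
                 v = \sum_(i in S) g S p i * (price p i - D i)].

Definition max_revenue1 (R : realType) (L Kb : nat) (g : choice_prob R L Kb)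
    (i : opt L Kb) (d : R) : R :=
  sup [set v | exists x : R, v = single g i x * (x - d)].

Fixpoint Vstar (R : realType) (L Kb : nat) (xi : 'I_L -> R) (Omega : finType)
    (pX : Omega -> R) (mu : R) (f : Omega -> choice_prob R L Kb) (t : nat)
    (S : {set opt L Kb}) : R :=
  if t is t'.+1 then
    Vstar xi pX mu f t' S
    + mu * expect pX (fun w => max_revenue (f w) S
        (fun i => Vstar xi pX mu f t' S - Vstar xi pX mu f t' (S :\ i)))
  else \sum_(i in S) salvage xi i.

Fixpoint backward (R : realType) (L Kb : nat) (xi : 'I_L -> R)
    (Omega : finType) (pX : Omega -> R) (mu : R)
    (f : Omega -> choice_prob R L Kb) (t : nat) (i : opt L Kb) : R :=
  if t is t'.+1 then
    backward xi pX mu f t' i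
    + mu * expect pX (fun w =>
        max_revenue1 (f w) i (backward xi pX mu f t' i))
  else salvage xi i.

Definition VU (R : realType) (L Kb : nat) (xi : 'I_L -> R) (Omega : finType)
    (pX : Omega -> R) (mu : R) (f : Omega -> choice_prob R L Kb) (t : nat)
    (S : {set opt L Kb}) : R :=
  \sum_(i in S) backward xi pX mu f t i.

(* [Num.truncn] is the floor on nonnegative reals. *)
Definition num_periods (R : realType) (mu lambda : R) : nat :=
  Num.truncn (lambda / mu).

(* Main.v *)
(** Since [\sum_i f_i <= 1], the right-hand side of the recursion for [V*] is
    monotone in the continuation values, so [V*] may be replaced there by [V^U];
    its increments [D_i] then become [r_i], and substitutability (p.4) bounds
    [f_i(p, S)] by [f_i(p, {i})].  The revenue splits over the options, and the
    upper bound follows by induction on [t].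

    For MNL, write [x = -1/beta] and [e_i] for the weight of option [i] at the
    price [r_i + x].  Then [x e_i] bounds the optimal revenue of [i] alone, by
    [y <= exp (y - 1)].  Posting these prices for [S], with [G = \sum_i e_i],
    shows that the gap [D_t(S) = V_t^U(S) - V_t^*(S)] satisfies
      [D_(t+1)(S) <= (1 - A_t) D_t(S) + A_t (x G_t + \sum_i D_t(S \ i))]
    with [A_t = mu E[G_t / (1 + G_t)]].  As [r_t] tends to infinity, [G_t] tends
    to [0]; the increments of [r_t] are [O(A_t)], so [\sum_t A_t] diverges and
    [D_t(S)] tends to [0] by induction on the size of [S]. *)
Require Import Defs.
From HB Require Import structures.
From mathcomp Require Import all_boot all_order all_algebra.
From mathcomp Require Import all_classical all_reals all_analysis.
From mathcomp Require Import ring lra.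
Import Order.TTheory GRing.Theory Num.Theory.
Import numFieldNormedType.Exports.
Local Open Scope classical_set_scope.
Local Open Scope ring_scope.

Set Implicit Arguments.
Unset Strict Implicit.

(** * Revenue bounds from domination by single-option probabilities *)

(* The consequences of (p.1)-(p.4) that the upper bound uses. *)
Record single_dominated (R : realType) (L Kb : nat) (S : {set opt L Kb})
    (g : choice_prob R L Kb) : Prop := SingleDominated {
  sd_ge0 : forall p i, i \in S -> 0 <= g S p i ;
  sd_sum : forall p, \sum_(i in S) g S p i <= 1 ;
  sd_single : forall p i, i \in S -> g S p i <= single g i (price p i) ;
  sd_ub : forall i d, i \in S ->
    has_ubound [set v | exists x : R, v = single g i x * (x - d)]
}.

Lemma max_revenue1_ub (R : realType) (L Kb : nat) (S : {set opt L Kb})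
    (g : choice_prob R L Kb) i d x :
  single_dominated S g -> i \in S ->
  single g i x * (x - d) <= max_revenue1 g i d.
Proof. by move=> sd iS; apply: ub_le_sup; [exact: (sd_ub sd d iS) | exists x]. Qed.

Lemma max_revenue1_ge0 (R : realType) (L Kb : nat) (S : {set opt L Kb})
    (g : choice_prob R L Kb) i d :
  single_dominated S g -> i \in S -> 0 <= max_revenue1 g i d.
Proof.
move=> sd iS; rewrite -[0](mulr0 (single g i d)) -(subrr d).
exact: max_revenue1_ub sd iS.
Qed.

(** Replacing each [D i] by [d i - c] costs at most [c] in total, because the choice probabilities
    sum to at most 1. In the application [c] is the gap between the upper bound and the value of
    [S]. *)
Lemma revenue_le (R : realType) (L Kb : nat) (S : {set opt L Kb})
    (g : choice_prob R L Kb) (D d : opt L Kb -> R) (c : R) p :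
  single_dominated S g -> 0 <= c -> (forall i, i \in S -> d i - c <= D i) ->
  \sum_(i in S) g S p i * (price p i - D i)
    <= \sum_(i in S) max_revenue1 g i (d i) + c.
Proof.
move=> sd c0 dD.
apply: (@le_trans _ _ (\sum_(i in S) (max_revenue1 g i (d i) + g S p i * c))).
  apply: ler_sum => i iS.
  have g0 := sd_ge0 sd p iS.
  have gs := sd_single sd p iS.
  have m0 := max_revenue1_ge0 (d i) sd iS.
  have m_ub := max_revenue1_ub (d i) (price p i) sd iS.
  have h1 : g S p i * (price p i - D i) <= g S p i * (price p i - d i + c).
    by apply: ler_wpM2l => //; have := dD i iS; lra.
  apply: (le_trans h1); rewrite mulrDr lerD2r.
  (* Domination by the single-option probability only helps when the margin is nonnegative; a
     negative margin is covered by the maximum being at least 0. *)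
  have [h|h] := leP (d i) (price p i).
    by apply: le_trans m_ub; rewrite ler_wpM2r// subr_ge0.
  by apply: le_trans m0; rewrite mulr_ge0_le0// subr_le0 ltW.
rewrite big_split /= lerD2l -mulr_suml.
by rewrite -[leRHS]mul1r ler_wpM2r// sd_sum.
Qed.

Lemma max_revenue_le (R : realType) (L Kb : nat) (S : {set opt L Kb})
    (g : choice_prob R L Kb) (D d : opt L Kb -> R) (c : R) :
  single_dominated S g -> 0 <= c -> (forall i, i \in S -> d i - c <= D i) ->
  max_revenue g S D <= \sum_(i in S) max_revenue1 g i (d i) + c.
Proof.
move=> sd c0 dD; apply: ge_sup.
  by exists (\sum_(i in S) g S 0 i * (price 0 i - D i)), 0.
by move=> _ [p ->]; exact: revenue_le.
Qed.

(** The reference costs [d] and the slack [c] serve to bound the revenues above, so that [sup] is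
    not its default value. *)
Lemma max_revenue_ub (R : realType) (L Kb : nat) (S : {set opt L Kb})
    (g : choice_prob R L Kb) (D d : opt L Kb -> R) (c : R) p :
  single_dominated S g -> 0 <= c -> (forall i, i \in S -> d i - c <= D i) ->
  \sum_(i in S) g S p i * (price p i - D i) <= max_revenue g S D.
Proof.
move=> sd c0 dD; apply: ub_le_sup; last by exists p.
by exists (\sum_(i in S) max_revenue1 g i (d i) + c) => _ [q ->]; exact: revenue_le.
Qed.

(** * Expectation over customer types *)

Lemma expect_const (R : realType) (Omega : finType) (pX : Omega -> R) (c : R) :
  is_pmf pX -> expect pX (fun=> c) = c.
Proof. by case=> _ h; rewrite /expect -mulr_suml h mul1r. Qed.

Lemma expectD (R : realType) (Omega : finType) (pX : Omega -> R) g h :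
  expect pX (fun w => g w + h w) = expect pX g + expect pX h.
Proof. by rewrite /expect -big_split; apply: eq_bigr => w _; rewrite mulrDr. Qed.

Lemma expectZ (R : realType) (Omega : finType) (pX : Omega -> R) c h :
  expect pX (fun w => c * h w) = c * expect pX h.
Proof. by rewrite /expect mulr_sumr; apply: eq_bigr => w _; rewrite mulrCA. Qed.

Lemma le_expect (R : realType) (Omega : finType) (pX : Omega -> R) g h :
  is_pmf pX -> (forall w, g w <= h w) -> expect pX g <= expect pX h.
Proof. by case=> p0 _ gh; apply: ler_sum => w _; exact: ler_wpM2l. Qed.

Lemma expect_sum (R : realType) (Omega I : finType) (pX : Omega -> R)
    (P : pred I) (h : Omega -> I -> R) :
  expect pX (fun w => \sum_(i | P i) h w i)
    = \sum_(i | P i) expect pX (fun w => h w i).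
Proof.
rewrite /expect exchange_big /=; apply: eq_bigr => w _.
by rewrite mulr_sumr.
Qed.

(** * The upper bound *)

Lemma VU_succ (R : realType) (L Kb : nat) (xi : 'I_L -> R) (Omega : finType)
    (pX : Omega -> R) (mu : R) (f : Omega -> choice_prob R L Kb) t
    (S : {set opt L Kb}) :
  VU xi pX mu f t.+1 S = VU xi pX mu f t S + mu * expect pX (fun w =>
    \sum_(i in S) max_revenue1 (f w) i (backward xi pX mu f t i)).
Proof. by rewrite /VU /= big_split /= expect_sum mulr_sumr. Qed.

Lemma VU_setD1 (R : realType) (L Kb : nat) (xi : 'I_L -> R) (Omega : finType)
    (pX : Omega -> R) (mu : R) (f : Omega -> choice_prob R L Kb) t
    (S : {set opt L Kb}) i : i \in S ->
  VU xi pX mu f t S = backward xi pX mu f t i + VU xi pX mu f t (S :\ i).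
Proof. by move=> iS; rewrite /VU (big_setD1 i). Qed.

(** Domination is assumed on all subsets of [S] because the recursion passes to [S :\ i]. In this
    form the bound serves general choice functions and also gives nonnegativity of the MNL gap. *)
Lemma Vstar_le_VU (R : realType) (L Kb : nat) (xi : 'I_L -> R) (Omega : finType)
    (pX : Omega -> R) (mu : R) (f : Omega -> choice_prob R L Kb)
    (S : {set opt L Kb}) t :
  is_pmf pX -> 0 < mu <= 1 ->
  (forall w (S' : {set opt L Kb}), S' \subset S -> single_dominated S' (f w)) ->
  Vstar xi pX mu f t S <= VU xi pX mu f t S.
Proof.
move=> hp /andP[mu0 mu1]; elim: t S => [//|t IH] S sd.
have IHS : forall S' : {set opt L Kb}, S' \subset S ->
    Vstar xi pX mu f t S' <= VU xi pX mu f t S'.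
  by move=> S' S'S; apply: IH => w S'' h; apply: sd (fintype.subset_trans h S'S).
rewrite VU_succ /=.
set V := Vstar xi pX mu f t; set U := VU xi pX mu f t.
have c0 : 0 <= U S - V S by rewrite subr_ge0 IHS.
(* The slack [U S - V S] comes back multiplied by [mu <= 1], so it is absorbed in passing from [V S]
   to [U S]. *)
suff : expect pX (fun w => max_revenue (f w) S (fun i => V S - V (S :\ i)))
    <= expect pX (fun w => \sum_(i in S) max_revenue1 (f w) i
         (backward xi pX mu f t i) + (U S - V S)).
  rewrite expectD expect_const// => h.
  have := ler_wpM2l (ltW mu0) h.
  have : mu * (U S - V S) <= U S - V S by rewrite -[leRHS]mul1r ler_wpM2r.
  lra.
apply: le_expect => // w; apply: max_revenue_le => //; first exact: sd.
move=> i iS; rewrite /U (VU_setD1 _ _ _ _ _ iS).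
have := IHS _ (subsetDl S [set i]%SET); rewrite -/V; lra.
Qed.

Lemma choice_function_dominated (R : realType) (L Kb Ks : nat) (Omega : finType)
    (f : Omega -> choice_prob R L Kb) (S : {set opt L Kb}) w :
  choice_function Ks f -> displayable Ks S -> single_dominated S (f w).
Proof.
move=> cf dS.
have d1 i : i \in S -> displayable Ks [set i]%SET.
  case: dS => S0 h SS0 iS; exists S0 => //; apply: fintype.subset_trans SS0.
  by rewrite finset.sub1set.
have singleE i p : i \in S -> f w [set i]%SET p i = single (f w) i (price p i).
  move=> iS; apply: (cf_local cf w (d1 _ iS)); last by rewrite finset.inE.
  by move=> j; rewrite finset.in_set1 => /eqP ->; rewrite /price mxE.
have s01 i x : i \in S -> 0 <= single (f w) i x <= 1.
  by move=> iS; apply: (cf_range cf w (d1 _ iS)); rewrite finset.inE.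
split.
- by move=> p i iS; have /andP[] := cf_range cf w dS p iS.
- by move=> p; exact: (cf_p1 cf w dS).
- move=> p i iS; rewrite -singleE//.
  (* Both probabilities are values of the same extension [ft] for [S], at the indicators of
     [[set i]] and of [S]; monotonicity compares them. *)
  have [ft /(_ p i iS)[_ mono _ ftE]] := cf_p4 cf w dS.
  rewrite -(ftE S)// -(ftE [set i]%SET) ?finset.sub1set ?finset.set11//.
  have cubeI (S' : {set opt L Kb}) : S' \subset S -> cube S (indic01 R S').
    move=> /fintype.subsetP S'S; split => j; rewrite /indic01.
      by case: (j \in S') => _; rewrite ?lexx ?ler01.
    by case: (boolP (j \in S')) => // /S'S ->.
  apply: mono; [by apply: cubeI; rewrite finset.sub1set | exact: cubeI | move=> j].
  rewrite /indic01 finset.in_set1; case: eqP => [->|_]; first by rewrite iS.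
  by rewrite ler0n.
- move=> i d iS.
  have := cf_p3 cf w (d1 _ iS) 0 (finset.set11 i).
  have -> : (fun x => x * f w [set i]%SET (set_price 0 i x) i)
      = (fun x => x * single (f w) i x).
    apply/funext => x; rewrite singleE//; congr (_ * single _ _ _).
    by rewrite /price /set_price mxE eqxx.
  move=> /cvgrPdist_le /(_ 1 ltr01) [M [_ hM]].
  (* Beyond [M], (p.3) gives [x * s <= 1], and [- (s * d) <= |d|]; up to [M] the margin itself is at
     most [|d| + |M|]. *)
  exists (1 + `|d| + `|M|) => _ [x ->].
  have /andP[s0 s1] := s01 i x iS.
  set s := single _ _ _ in s0 s1 *.
  have [xM|xM] := leP x M.
    have [h|h] := leP x d.
      by apply: (@le_trans _ _ 0); 
        [rewrite mulr_ge0_le0// subr_le0 | rewrite !addr_ge0].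
    have : s * (x - d) <= 1 * (x - d) by rewrite ler_wpM2r// subr_ge0 ltW.
    have := ler_norm M; have := ler_norm (- d); rewrite normrN; lra.
  have /= := hM x xM; rewrite sub0r normrN => h.
  have := le_trans (ler_norm _) h; rewrite -/s => {}h.
  have : - (s * d) <= `|d|.
    apply: (le_trans (ler_norm _)); rewrite normrN normrM (ger0_norm s0).
    by rewrite -[leRHS]mul1r ler_wpM2r.
  have := normr_ge0 M; lra.
Qed.

(** * MNL: single-option revenue and domination *)

Lemma single_mnlE (R : realType) (L Kb : nat) (Omega : finType)
    (q : Omega -> opt L Kb -> R) (beta : R) w i x :
  single (mnl q beta w) i x
    = expR (q w i + beta * x) / (1 + expR (q w i + beta * x)).
Proof. by rewrite /single /mnl finset.set11 finset.big_set1 /price mxE. Qed.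

(** Once the denominator is dropped, [expR (q w i + beta * x) * (x - d)] is maximal at
    [x = d - beta^-1], and the right-hand side is its value there. *)
Lemma single_mnl_revenue_le (R : realType) (L Kb : nat) (Omega : finType)
    (q : Omega -> opt L Kb -> R) (beta : R) w i d x : beta < 0 ->
  single (mnl q beta w) i x * (x - d)
    <= - beta^-1 * expR (q w i + beta * (d - beta^-1)).
Proof.
move=> b0; rewrite single_mnlE.
have bN : beta != 0 by rewrite lt_eqF.
have c0 : 0 < - beta^-1 by rewrite oppr_gt0 invr_lt0.
set e := expR (q w i + beta * x).
have e0 : 0 < e := expR_gt0 _.
have [h|h] := leP x d.
  apply: (@le_trans _ _ 0).
    by rewrite mulr_ge0_le0 ?subr_le0// divr_ge0// ltW// addr_gt0.
  by rewrite mulr_ge0 ?expR_ge0// ltW.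
apply: (@le_trans _ _ (e * (x - d))).
  rewrite ler_wpM2r ?subr_ge0 ?(ltW h)// ler_pdivrMr ?addr_gt0//.
  by rewrite -[leLHS]mulr1 ler_wpM2l ?(ltW e0)// lerDl ltW.
have -> : x - d = - beta^-1 * (- beta * (x - d)) by field.
rewrite mulrCA ler_wpM2l ?(ltW c0)//.
have -> : q w i + beta * (d - beta^-1)
    = (q w i + beta * x) + (- beta * (x - d) - 1) by field.
rewrite [leRHS]expRD ler_wpM2l ?(ltW e0)//.
have := expR_ge1Dx (- beta * (x - d) - 1); lra.
Qed.

(** Displaying [i] alone shrinks the denominator, which raises its probability. *)
Lemma mnl_dominated (R : realType) (L Kb : nat) (Omega : finType)
    (q : Omega -> opt L Kb -> R) (beta : R) w (S : {set opt L Kb}) :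
  beta < 0 -> single_dominated S (mnl q beta w).
Proof.
move=> b0.
have G0 p : 0 <= \sum_(j in S) expR (q w j + beta * price p j).
  by apply: sumr_ge0 => j _; exact: expR_ge0.
have G1 p : 0 < 1 + \sum_(j in S) expR (q w j + beta * price p j).
  by rewrite ltr_pwDl.
split.
- by move=> p i iS; rewrite /mnl iS divr_ge0 ?expR_ge0// ltW.
- move=> p; rewrite /mnl.
  under eq_bigr => i iS do rewrite iS.
  by rewrite -mulr_suml ler_pdivrMr// mul1r lerDr.
- move=> p i iS; rewrite single_mnlE /mnl iS ler_wpM2l ?expR_ge0//.
  rewrite lef_pV2 ?posrE ?ltr_pwDl ?expR_ge0// lerD2l.
  by rewrite (big_setD1 i)//= lerDl; apply: sumr_ge0 => j _; exact: expR_ge0.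
- move=> i d iS; exists (- beta^-1 * expR (q w i + beta * (d - beta^-1))).
  by move=> _ [x ->]; exact: single_mnl_revenue_le.
Qed.

(** * A contraction whose rates have divergent sum *)

Lemma contraction_cvg0 (R : realType) (D A eps r : R^nat) (C : R) :
  0 < C -> (forall t, 0 <= D t) -> (forall t, 0 <= A t <= 1) ->
  (forall t, D t.+1 <= (1 - A t) * D t + A t * eps t) ->
  eps @ \oo --> (0 : R) -> r @ \oo --> +oo ->
  (\forall t \near \oo, r t.+1 - r t <= C * A t) ->
  D @ \oo --> (0 : R).
Proof.
move=> C0 D0 A01 Drec eps0 rinf rA; apply/cvgrPdist_le => e e0.
have e2 : 0 < e / 2 by rewrite divr_gt0.
have [N _ hN] : \forall t \near \oo, eps t <= e / 2 /\ r t.+1 - r t <= C * A t.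
  near=> t; split; last by near: t.
  apply: le_trans (ler_norm _) _; rewrite -normrN -[- _]add0r.
  by near: t; move/cvgrPdist_le : eps0; apply.
have {}hN t : (N <= t)%N -> eps t <= e / 2 /\ r t.+1 - r t <= C * A t by exact: hN.
(* Past [N], a value of [D] at most [e] stays so, each next value being bounded by a convex
   combination of [D] and [eps]. It remains to exclude that [D] exceeds [e] forever. *)
have [[n Nn Dn]|hD] := pselect (exists2 n, (N <= n)%N & D n <= e).
  exists n => //= t /subnKC <-; rewrite sub0r normrN ger0_norm//.
  elim: (t - n)%N => [|k IH]; first by rewrite addn0.
  rewrite addnS; apply: (le_trans (Drec _)).
  have [ek _] := hN (n + k)%N (leq_trans Nn (leq_addr _ _)).
  have /andP[a0 a1] := A01 (n + k)%N.
  have := ler_wpM2l a0 ek.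
  have : (1 - A (n + k)%N) * D (n + k)%N <= (1 - A (n + k)%N) * e.
    by rewrite ler_wpM2l// subr_ge0.
  have : 0 <= A (n + k)%N * e by rewrite mulr_ge0// ltW.
  lra.
exfalso.
have {}hD t : (N <= t)%N -> e < D t.
  by move=> Nt; rewrite ltNge; apply/negP => h; apply: hD; exists t.
(* While [D > e], each step lowers [D] by at least [A t * (e / 2)], which is at least [k] times the
   increment of [r]. So [D + k r] does not increase, contradicting [D >= 0] and the divergence of
   [r]. *)
pose k := e / 2 / C.
have k0 : 0 < k by rewrite divr_gt0.
have dec t : D (N + t)%N + k * r (N + t)%N <= D N + k * r N.
  elim: t => [|t IH]; first by rewrite addn0.
  apply: le_trans IH; rewrite addnS.
  have [ek rk] := hN (N + t)%N (leq_addr _ _).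
  have := Drec (N + t)%N; have /andP[a0 a1] := A01 (N + t)%N.
  have de := hD (N + t)%N (leq_addr _ _).
  have := ler_wpM2l (ltW k0) rk.
  have -> : k * (C * A (N + t)%N) = A (N + t)%N * (e / 2).
    by rewrite /k; field; rewrite gt_eqF.
  have : A (N + t)%N * (e / 2) <= A (N + t)%N * (D (N + t)%N - eps (N + t)%N).
    by apply: ler_wpM2l => //; lra.
  lra.
have [M _ hM] : \forall t \near \oo, (D N + k * r N) / k + 1 <= r t.
  by move/cvgryPge : rinf; apply.
have /= := hM (N + M)%N (leq_addl _ _).
rewrite -(ler_pM2l k0) mulrDr mulr1 mulrCA divff ?gt_eqF// mulr1 => h.
have := dec M; have := D0 (N + M)%N; lra.
Unshelve. all: by end_near.
Qed.

(** * MNL: one-period revenue gap *)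

(* The weight of option [i] at a markup of [- beta^-1] over its cost [d]. *)
Definition mnl_weight (R : realType) (L Kb : nat) (Omega : finType)
    (q : Omega -> opt L Kb -> R) (beta : R) (w : Omega) (i : opt L Kb)
    (d : R) : R := expR (q w i + beta * (d - beta^-1)).

Lemma mnl_max_revenue1_le (R : realType) (L Kb : nat) (Omega : finType)
    (q : Omega -> opt L Kb -> R) (beta : R) w i d : beta < 0 ->
  max_revenue1 (mnl q beta w) i d <= - beta^-1 * mnl_weight q beta w i d.
Proof.
move=> b0; apply: ge_sup; first by exists (single (mnl q beta w) i 0 * (0 - d)), 0.
by move=> _ [x ->]; exact: single_mnl_revenue_le.
Qed.

Lemma mnl_max_revenue1_ge (R : realType) (L Kb : nat) (Omega : finType)
    (q : Omega -> opt L Kb -> R) (beta : R) w i d : beta < 0 ->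
  - beta^-1 * (mnl_weight q beta w i d / (1 + mnl_weight q beta w i d))
    <= max_revenue1 (mnl q beta w) i d.
Proof.
move=> b0; have sd := mnl_dominated q w [set i]%SET b0.
have := max_revenue1_ub d (d - beta^-1) sd (finset.set11 i).
by rewrite single_mnlE -/(mnl_weight q beta w i d) addrAC subrr add0r mulrC.
Qed.

(** At the prices [d i - beta^-1], option [i] sells with probability its weight over [1 + G], at a
    margin of at least [- beta^-1 + c - a]. Later [c] is the gap of [S] and [a] bounds the gaps of
    the sets [S :\ i]. *)
Lemma mnl_revenue_gap (R : realType) (L Kb : nat) (Omega : finType)
    (q : Omega -> opt L Kb -> R) (beta : R) w (S : {set opt L Kb})
    (D d : opt L Kb -> R) (c a G : R) :
  beta < 0 -> 0 <= c -> (forall i, i \in S -> d i - c <= D i <= d i - c + a) ->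
  G = \sum_(i in S) mnl_weight q beta w i (d i) ->
  \sum_(i in S) max_revenue1 (mnl q beta w) i (d i)
      - max_revenue (mnl q beta w) S D
    <= G / (1 + G) * (- beta^-1 * G - c + a).
Proof.
move=> b0 c0 dD GE.
have G0 : 0 <= G by rewrite GE; apply: sumr_ge0 => i _; exact: expR_ge0.
have G1 : 0 < 1 + G by rewrite ltr_pwDl.
have m_le : \sum_(i in S) max_revenue1 (mnl q beta w) i (d i) <= - beta^-1 * G.
  by rewrite GE mulr_sumr; apply: ler_sum => i _; exact: mnl_max_revenue1_le.
pose p : 'rV[R]_#|opt L Kb| := \row_k (d (enum_val k) - beta^-1).
have pE i : price p i = d i - beta^-1 by rewrite /price mxE enum_rankK.
have : \sum_(i in S) mnl q beta w S p i * (price p i - D i)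
    <= max_revenue (mnl q beta w) S D.
  apply: (@max_revenue_ub _ _ _ _ _ _ d c) => //; first exact: mnl_dominated.
  by move=> i /dD /andP[].
have : G / (1 + G) * (- beta^-1 + c - a)
    <= \sum_(i in S) mnl q beta w S p i * (price p i - D i).
  rewrite {1}GE -mulrA mulr_suml; apply: ler_sum => i iS.
  rewrite /mnl iS (eq_bigr (fun j => mnl_weight q beta w j (d j))) => [|j _];
    last by rewrite pE.
  rewrite -GE pE -/(mnl_weight q beta w i (d i)) -mulrA ler_wpM2l ?expR_ge0//.
  rewrite ler_wpM2l ?invr_ge0 ?(ltW G1)//.
  by have /andP[_] := dD i iS; lra.
(* With the factor [G / (1 + G)] extracted, the zeroth-order [- beta^-1] cancels and only
   [- beta^-1 * G] is left. *)
have : - beta^-1 * G = G / (1 + G) * (- beta^-1 * G - beta^-1).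
  by field; rewrite lt_eqF// gt_eqF.
move: (G / (1 + G)) m_le => F; lra.
Qed.

(** * MNL: divergence of the backward bound *)

Lemma mnl_backward_nondecreasing (R : realType) (L Kb : nat) (xi : 'I_L -> R)
    (Omega : finType) (pX : Omega -> R) (mu : R)
    (q : Omega -> opt L Kb -> R) (beta : R) i :
  is_pmf pX -> 0 < mu -> beta < 0 ->
  nondecreasing_seq (fun t => backward xi pX mu (mnl q beta) t i).
Proof.
move=> hp mu0 b0; apply/nondecreasing_seqP => t /=; rewrite lerDl.
apply: mulr_ge0; first exact: ltW.
rewrite -(expect_const 0 hp); apply: le_expect => // w.
apply: (@max_revenue1_ge0 _ _ _ [set i]%SET); last exact: finset.set11.
exact: mnl_dominated.
Qed.

(** Some types may have probability 0, but not all, since the total is 1. *)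
Lemma pmf_expect_gt0 (R : realType) (Omega : finType) (pX : Omega -> R) h :
  is_pmf pX -> (forall w, 0 < h w) -> 0 < expect pX h.
Proof.
move=> [p0 p1] h0; rewrite lt_neqAle sumr_ge0 ?andbT; last first.
  by move=> w _; rewrite mulr_ge0 ?p0// ltW.
apply/eqP => /esym /eqP; rewrite psumr_eq0; last first.
  by move=> w _; rewrite mulr_ge0 ?p0// ltW.
move=> /allP z; have : \sum_w pX w = 0.
  apply: big1 => w _; apply/eqP; have := z w (mem_index_enum w).
  by rewrite /= mulf_eq0 (gt_eqF (h0 w)) orbF.
by move/eqP; rewrite p1 oner_eq0.
Qed.

Lemma mnl_backward_cvgy (R : realType) (L Kb : nat) (xi : 'I_L -> R)
    (Omega : finType) (pX : Omega -> R) (mu : R)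
    (q : Omega -> opt L Kb -> R) (beta : R) i :
  is_pmf pX -> 0 < mu -> beta < 0 ->
  backward xi pX mu (mnl q beta) t i @[t --> \oo] --> +oo.
Proof.
move=> hp mu0 b0; set r := fun t => backward xi pX mu (mnl q beta) t i.
have rnd := mnl_backward_nondecreasing xi q i hp mu0 b0.
apply: nondecreasing_dvgn_lt => // /cvg_seq_bounded [M [_ hM]].
have {hM} rM t : r t <= M + 1.
  by apply: le_trans (ler_norm _) _; apply: (hM (M + 1) _ t I); rewrite ltrDl.
(* Weights decrease in the cost, so if [r] stayed below [M + 1], each increment would be at least
   the constant [c > 0], forcing linear growth. *)
pose k w := mnl_weight q beta w i (M + 1).
pose c := mu * expect pX (fun w => - beta^-1 * (k w / (1 + k w))).
have c0 : 0 < c.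
  rewrite mulr_gt0// pmf_expect_gt0// => w.
  by rewrite mulr_gt0 ?oppr_gt0 ?invr_lt0// divr_gt0 ?addr_gt0 ?expR_gt0.
have step t : r t + c <= r t.+1.
  rewrite lerD2l ler_wpM2l ?(ltW mu0)//; apply: le_expect => // w.
  apply: le_trans (mnl_max_revenue1_ge q w i (r t) b0).
  rewrite ler_wpM2l ?oppr_ge0 ?invr_le0 ?(ltW b0)//.
  have k0 : 0 < k w := expR_gt0 _.
  have kr : k w <= mnl_weight q beta w i (r t).
    by rewrite ler_expR lerD2l ler_wnM2l ?(ltW b0)// lerD2r.
  have W0 : 0 < mnl_weight q beta w i (r t) := expR_gt0 _.
  rewrite ler_pdivrMr ?addr_gt0// mulrAC ler_pdivlMr ?addr_gt0//; lra.
have lin n : r 0%N + n%:R * c <= r n.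
  elim: n => [|n IH]; first by rewrite mul0r addr0.
  by rewrite -natr1 mulrDl mul1r; have := step n; lra.
have := archi_boundP (normr_ge0 ((M + 1 - r 0%N) / c)).
set n := Num.bound _ => hn.
have := le_lt_trans (ler_norm _) hn; rewrite ltr_pdivrMr//.
by have := lin n; have := rM n; lra.
Qed.

Lemma mnl_weight_cvg0 (R : realType) (L Kb : nat) (Omega : finType)
    (q : Omega -> opt L Kb -> R) (beta : R) w i (r : R^nat) :
  beta < 0 -> r @ \oo --> +oo ->
  mnl_weight q beta w i (r t) @[t --> \oo] --> (0 : R).
Proof.
move=> b0 rinf.
have -> : (fun t => mnl_weight q beta w i (r t))
    = (fun x => expR (- x)) \o (fun t => - (q w i + beta * (r t - beta^-1))).
  by apply/funext => t /=; rewrite opprK.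
suff h : - (q w i + beta * (r t - beta^-1)) @[t --> \oo] --> +oo.
  exact: (cvg_comp _ _ h (@cvgr_expR R)).
apply/cvgryPge => A; move/cvgryPge/(_ ((A + q w i) / - beta + beta^-1)) : rinf.
apply: filterS => t /=; rewrite -lerBrDr ler_pdivrMr ?oppr_gt0// => h; lra.
Qed.

(** * MNL: the gap vanishes *)

Lemma num_periods_cvg (R : realType) (mu : R) : 0 < mu ->
  num_periods mu lambda @[lambda --> +oo] --> \oo.
Proof.
move=> mu0; apply/cvgnyPge => A; near=> lambda.
have h : A%:R * mu <= lambda.
  by near: lambda; apply: nbhs_pinfty_ge; exact: num_real.
rewrite /num_periods truncn_ge_nat ?ler_pdivlMr//.
Unshelve. all: by end_near.
Qed.

Lemma Vstar_set0 (R : realType) (L Kb : nat) (xi : 'I_L -> R)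
    (Omega : finType) (pX : Omega -> R) (mu : R)
    (f : Omega -> choice_prob R L Kb) t :
  Vstar xi pX mu f t finset.set0 = 0.
Proof.
elim: t => [|t IH] /=; first by rewrite finset.big_set0.
rewrite IH add0r /expect big1 ?mulr0// => w _.
rewrite (_ : max_revenue _ _ _ = 0) ?mulr0// /max_revenue.
rewrite [X in sup X](_ : _ = [set 0]) ?sup1//.
apply/seteqP; split => v /=; first by case=> p ->; rewrite finset.big_set0.
by move=> ->; exists 0; rewrite finset.big_set0.
Qed.

Lemma mnl_gap_cvg0 (R : realType) (L Kb : nat) (xi : 'I_L -> R)
    (Omega : finType) (pX : Omega -> R) (mu : R)
    (q : Omega -> opt L Kb -> R) (beta : R) (S : {set opt L Kb}) :
  is_pmf pX -> 0 < mu <= 1 -> beta < 0 ->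
  VU xi pX mu (mnl q beta) t S - Vstar xi pX mu (mnl q beta) t S
    @[t --> \oo] --> (0 : R).
Proof.
move=> hp hmu b0; have /andP[mu0 mu1] := hmu.
set U := VU xi pX mu (mnl q beta); set V := Vstar xi pX mu (mnl q beta).
have D0 t (S' : {set opt L Kb}) : 0 <= U t S' - V t S'.
  rewrite subr_ge0; apply: Vstar_le_VU => // w S'' _; exact: mnl_dominated.
have x0 : 0 < - beta^-1 by rewrite oppr_gt0 invr_lt0.
have [n] := ubnP #|S|; elim: n S => // n IH S cardS.
pose r t i := backward xi pX mu (mnl q beta) t i.
pose G w t := \sum_(i in S) mnl_weight q beta w i (r t i).
pose F w t := G w t / (1 + G w t).
pose A t := mu * expect pX (F ^~ t).
(* [a] dominates the gap of each [S :\ i]. Likewise [Gs] dominates [G w] for every type, so it can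
   leave the expectation. *)
pose a t := \sum_(i in S) (U t (S :\ i) - V t (S :\ i)).
pose Gs t := \sum_w G w t.
have rinf i : r t i @[t --> \oo] --> +oo by exact: mnl_backward_cvgy.
have G0 w t : 0 <= G w t by apply: sumr_ge0 => i _; exact: expR_ge0.
have F01 w t : 0 <= F w t <= 1.
  have h : 0 < 1 + G w t by rewrite ltr_pwDl.
  by rewrite divr_ge0 ?(ltW h)//= ler_pdivrMr// mul1r lerDr.
have GGs w t : G w t <= Gs t.
  by rewrite /Gs (bigD1 w)//= lerDl sumr_ge0.
have a0 : a @ \oo --> (0 : R).
  rewrite (_ : 0 = \sum_(i in S) (0 : R)); last by rewrite big1.
  apply: cvg_big; first exact: add_continuous.
  by move=> i iS; apply: IH;
    rewrite -ltnS (leq_trans _ cardS)// ltnS [ltnRHS](cardsD1 i) iS.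
have Gs0 : Gs @ \oo --> (0 : R).
  rewrite (_ : 0 = \sum_(w : Omega) \sum_(i in S) (0 : R)); last by rewrite !big1.
  apply: cvg_big; first exact: add_continuous.
  move=> w _; apply: cvg_big; first exact: add_continuous.
  by move=> i _; exact: mnl_weight_cvg0.
(* For empty [S] the rate [A] is 0 and nothing contracts; otherwise any [i0] in [S] supplies the
   divergent sequence [r ^~ i0]. *)
have [->|[i0 i0S]] := set_0Vmem S.
  have UV0 t : U t finset.set0 - V t finset.set0 = 0.
    by rewrite /V Vstar_set0 /U /VU !finset.big_set0 subrr.
  by under eq_fun do rewrite UV0; exact: cvg_cst.
apply: (@contraction_cvg0 _ _ A (fun t => - beta^-1 * Gs t + a t) (r ^~ i0)
  (2 * - beta^-1)) => //.
- by rewrite mulr_gt0.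
- move=> t; rewrite mulr_ge0 ?(ltW mu0)//=; last first.
    by rewrite -(expect_const 0 hp) le_expect// => w; have /andP[] := F01 w t.
  have : expect pX (F ^~ t) <= 1.
    by rewrite -[leRHS](expect_const 1 hp) le_expect// => w; have /andP[] := F01 w t.
  move=> /(ler_wpM2l (ltW mu0)); rewrite mulr1 => h; exact: le_trans h mu1.
- move=> t; rewrite /U VU_succ -/U /V /= -/V.
  set D := fun i => _ - _.
  (* In the added term only [F w t] depends on the type, so averaging and multiplying by [mu]
     produces [A t]. *)
  suff : expect pX (fun w => \sum_(i in S) max_revenue1 (mnl q beta w) i (r t i))
      <= expect pX (fun w => max_revenue (mnl q beta w) S D
           + (- beta^-1 * Gs t - (U t S - V t S) + a t) * F w t).
    rewrite expectD expectZ -/(F ^~ t) => /(ler_wpM2l (ltW mu0)).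
    rewrite /A /r -/(V t); lra.
  apply: le_expect => // w; rewrite -lerBlDl.
  apply: le_trans (@mnl_revenue_gap _ _ _ _ q beta w S D (r t)
    (U t S - V t S) (a t) (G w t) b0 (D0 _ _) _ erefl) _.
    move=> i iS; rewrite /D.
    have Ui : U t S = r t i + U t (S :\ i) by exact: VU_setD1.
    have : U t (S :\ i) - V t (S :\ i) <= a t.
      by rewrite /a (bigD1 i)//= lerDl sumr_ge0.
    have := D0 t (S :\ i); rewrite -/(V t); lra.
  rewrite -/(F w t) [leRHS]mulrC; have /andP[f0 _] := F01 w t.
  apply: ler_wpM2l => //; have := ler_wpM2l (ltW x0) (GGs w t); lra.
- rewrite -(mulr0 (- beta^-1)) -[X in _ --> X]addr0.
  by apply: cvgD => //; apply: cvgM => //; exact: cvg_cst.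
(* Eventually [G w t <= 1] for all types, hence [G w t <= 2 * F w t]; this is the 2 in the constant
   [2 * - beta^-1]. *)
- near=> t.
  have Gs1 : Gs t <= 1.
    by near: t; apply: cvgr_le (ltr01); exact: Gs0.
  rewrite /r /= [X in X <= _]addrC addKr.
  rewrite /A mulrCA ler_wpM2l ?(ltW mu0)// -expectZ; apply: le_expect => // w.
  apply: le_trans (mnl_max_revenue1_le q w i0 _ b0) _.
  rewrite [2 * _]mulrC -mulrA ler_wpM2l ?(ltW x0)//.
  have G1 : G w t <= 1 := le_trans (GGs w t) Gs1.
  apply: (@le_trans _ _ (G w t)).
    by rewrite /G (bigD1 i0)//= lerDl sumr_ge0// => i _; exact: expR_ge0.
  rewrite mulrA ler_pdivlMr ?ltr_pwDl// mulrC.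
  by rewrite ler_wpM2r//; lra.
Unshelve. all: by end_near.
Qed.

(** * Both claims for subsets of a feasible set *)

Unset Implicit Arguments.

Theorem proposition1 (R : realType) (L Kb Ks : nat) (xi : 'I_L -> R)
    (Omega : finType) (pX : Omega -> R) (mu : R)
    (hpX : is_pmf pX) (hmu : 0 < mu <= 1)
    (Sbar : {set opt L Kb}) (hSbar : feasible Ks Sbar) :
  (forall f : Omega -> choice_prob R L Kb, choice_function Ks f ->
     forall lambda : R, 0 <= lambda ->
     forall S : {set opt L Kb}, S \subset Sbar ->
     forall t : nat, (t <= num_periods mu lambda)%N ->
       Vstar xi pX mu f t S <= VU xi pX mu f t S)
  /\
  (forall (q : Omega -> opt L Kb -> R) (beta : R), beta < 0 ->
     forall S : {set opt L Kb}, S \subset Sbar ->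
       (Vstar xi pX mu (mnl q beta) (num_periods mu lambda) S
          - VU xi pX mu (mnl q beta) (num_periods mu lambda) S)
         @[lambda --> +oo] --> (0 : R)).
Proof.
split.
- move=> f cf _ _ S SSbar t _; apply: Vstar_le_VU => // w S' S'S.
  apply: choice_function_dominated cf _; exists Sbar => //.
  exact: fintype.subset_trans S'S SSbar.
- move=> q beta b0 S _; have /andP[mu0 _] := hmu.
  have := cvg_comp _ _ (num_periods_cvg mu0)
    (mnl_gap_cvg0 xi q S hpX hmu b0).
  move=> /cvgN; rewrite oppr0; apply: cvg_trans; apply: near_eq_cvg.
  by apply: nearW => lambda /=; rewrite opprB.
Qed.
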